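(* Let $\lambda$ be a partition and $p$ a positive integer. Then, as Taylor series at infinity (expansion in descending powers of $z$), \[(z)_p\,\frac{F(z-p;\lambda)}{F(z;\lambda)}=-p\sum_{r,s,t\ge 0}(-1)^s\binom{r+s-1}{s}\,s(p,t)\,c^\lambda_r(p)\,z^{t-r-s}.\]
   Context: $(z)_p=z(z-1)\cdots(z-p+1)$ is the lowering factorial, and the Stirling numbers of the first kind $s(p,t)$ are defined by $(z)_p=\sum_{t} s(p,t)z^t$ (so $s(p,t)=0$ unless $1\le t\le p$). The binomial coefficient $\binom{r+s-1}{s}$ is the coefficient of $z^{-r-s}$ in $(1+z)^{-r}$ expanded at infinity; in particular for $r=0$ it equals $1$ if $s=0$ and $0$ if $s\ge1$. The Frobenius function is $F(z;\lambda)=\prod_{i\ge1}\frac{z-\lambda_i+i}{z+i}$. For a finite integer sequence $\lambda=(\lambda_1,\ldots,\lambda_l)$ (in particular a partition, with $l=l(\lambda)$) and an indeterminate $x$, the quantities $c^\lambda_r(x)$, $r\ge0$, are defined by the expansion in descending powers of $y$ \[\prod_{i=1}^{l}\frac{(x-y+1+\lambda_i-i)(-y+1-i)}{(x-y+1-i)(-y+1+\lambda_i-i)}=-x\sum_{r\ge 0}c^\lambda_r(x)\,y^{-r}.\] For a partition this left side equals $\frac{C_\lambda(x-y+1)}{C_\lambda(x-y)}\frac{C_\lambda(-y)}{C_\lambda(-y+1)}$, where $C_\lambda(z)=\prod_{(i,j)\in\lambda}(z+j-i)$ is the content polynomial (product over the cells $(i,j)$, $1\le i\le l(\lambda)$,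 $1\le j\le\lambda_i$, of the Ferrers diagram). In particular $c^\lambda_0(x)=-1/x$. *)

(* Defs.v *)
From HB Require Import structures.
From mathcomp Require Import all_boot all_order all_algebra.

Set Implicit Arguments.
Unset Strict Implicit.
Unset Printing Implicit Defensive.

Import GRing.Theory Num.Theory.
Local Open Scope ring_scope.
Local Open Scope quotient_scope.

Notation "'{ratfun' K }" := {fraction {poly K}}
  (at level 0, format "'{ratfun'  K }") : type_scope.
Notation tofrac := (@FracField.tofrac _).

Definition ratfun_num (K : fieldType) (f : {ratfun K}) : {poly K} := \n_(repr f).
Definition ratfun_den (K : fieldType) (f : {ratfun K}) : {poly K} := \d_(repr f).

(* Value of a rational function, read off after cancelling the gcd of the
   chosen numerator and denominator; it is junk (0) at a pole.  See
   ratfun_evalE. *)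
Definition ratfun_eval (K : fieldType) (f : {ratfun K}) (a : K) : K :=
  let n := ratfun_num f in let d := ratfun_den f in let g := gcdp n d in
  (n %/ g).[a] / (d %/ g).[a].

(* Coefficient of z^k in the expansion of f in descending powers of z.
   Writing z^m f = q + r/d with deg r < deg d, the term r/d only contributes
   negative powers, so the coefficient of z^i in z^m f is q`_i (i >= 0); take
   m = 0, i = k if k >= 0 and m = -k, i = 0 if k < 0.  See coef_inftyP. *)
Definition coef_infty (K : fieldType) (f : {ratfun K}) (k : int) : K :=
  let n := ratfun_num f in let d := ratfun_den f in
  match k with
  | Posz i => (n %/ d)`_i
  | Negz m => (('X^(m.+1) * n) %/ d)`_0
  end.

(* A formal series sum_k a_k z^k (k : int) is given by its coefficients. *)
Definition zmonomial (K : fieldType) (a : K) (e : int) : int -> K :=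
  fun k => if k == e then a else 0.

(* The family F is summable with sum S: each power of z receives nonzero
   contributions from finitely many members only, and they add up to S. *)
Definition formal_sum (K : fieldType) (I : eqType) (F : I -> int -> K)
    (S : int -> K) : Prop :=
  forall k : int, exists J : seq I,
    [/\ uniq J, forall i, i \notin J -> F i k = 0
      & S k = \sum_(i <- J) F i k].

Definition lowering_factorial (R : pzRingType) (w : R) (p : nat) : R :=
  \prod_(i < p) (w - i%:R).

Definition stirling1 (p t : nat) : int :=
  (lowering_factorial ('X : {poly int}) p)`_t.

(* The binomial (r+s-1 choose s), with
   (1 + z)^(-r) = sum_s (-1)^s (r+s-1 choose s) z^(-r-s) at infinity.  The
   truncated predecessor gives the right values at r = 0: 1 if s = 0, and
   'C(s-1, s) = 0 if s > 0. *)
Definition negbinom (r s : nat) : nat := 'C((r + s).-1, s).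

Definition is_partition (lam : seq nat) : bool :=
  sorted geq lam && (0%N \notin lam).

(* lambda_i is nth 0 lam (i - 1); the factors with i > size lam equal 1. *)
Definition frobenius (K : fieldType) (w : K) (lam : seq nat) : K :=
  \prod_(i < size lam)
     ((w - (nth 0%N lam i)%:R + i.+1%:R) / (w + i.+1%:R)).

Definition cratio (K : fieldType) (x y : K) (lam : seq nat) : K :=
  \prod_(i < size lam)
     (((x - y + 1 + (nth 0%N lam i)%:R - i.+1%:R) * (- y + 1 - i.+1%:R))
      / ((x - y + 1 - i.+1%:R) * (- y + 1 + (nth 0%N lam i)%:R - i.+1%:R))).

(* The coefficient c_r in Q(x), where x is an indeterminate: cratio, which has
   degree 0 in y, is expanded in y over the field Q(x) and equals
   - x * sum_(r >= 0) c_r y^(-r).  At x = 0 cratio is 1, so c_r is a polynomial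
   in x for r > 0 while c_0 = - 1/x; evaluation at a nonzero x meets no pole. *)
Definition ccoef (lam : seq nat) (r : nat) : {ratfun rat} :=
  let x : {ratfun rat} := tofrac 'X in
  let y : {ratfun {ratfun rat}} := tofrac 'X in
  - coef_infty (cratio (tofrac x%:P) y lam) (- r%:Z) / x.

Section Sanity.
Variable K : fieldType.
Implicit Types (n d : {poly K}) (f : {ratfun K}).

Lemma ratfun_den_neq0 f : ratfun_den f != 0.
Proof. exact: denom_ratioP. Qed.

Lemma ratfun_numden f : f * tofrac (ratfun_den f) = tofrac (ratfun_num f).
Proof.
rewrite /ratfun_num /ratfun_den -{1}[f]reprK; set u := repr f.
rewrite -[_ * _]/(FracField.mul _ _); apply/eqP.
rewrite !piE FracField.equivfE /FracField.mulf.
have d0 : \d_u != 0 := denom_ratioP u.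
by rewrite !numden_Ratio ?oner_neq0 ?mulf_neq0 ?oner_neq0 // !mulr1 mulrC.
Qed.

Lemma ratfun_eq n d f : d != 0 -> f = tofrac n / tofrac d ->
  ratfun_num f * d = n * ratfun_den f.
Proof.
move=> d0 ef; apply/eqP; rewrite -tofrac_eq !tofracM -ratfun_numden.
rewrite [X in X * _ * _]ef mulrAC -(mulrA (tofrac n)) mulVf ?mulr1 //.
by rewrite tofrac_eq0.
Qed.

Lemma ratfun_evalE n d (a : K) : d.[a] != 0 ->
  ratfun_eval (tofrac n / tofrac d) a = n.[a] / d.[a].
Proof.
move=> da; have d0 : d != 0 by apply: contraNneq da => ->; rewrite horner0.
have := ratfun_eq (n := n) d0 erefl; have e0 := ratfun_den_neq0 (tofrac n / tofrac d).
rewrite /ratfun_eval; move: (ratfun_num _) (ratfun_den _) e0 => m e e0 H.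
set g := gcdp m e; have g0 : g != 0 by rewrite gcdp_eq0 negb_and e0 orbT.
have /divpK em := dvdp_gcdl m e; have /divpK ee := dvdp_gcdr m e.
have E : m %/ g * d = n * (e %/ g).
  by apply: (mulIf g0); rewrite mulrAC em H -mulrA ee.
have cop : coprimep (m %/ g) (e %/ g) by apply: coprimep_div_gcd; rewrite e0 orbT.
have ea : (e %/ g).[a] != 0.
  have : e %/ g %| d.
    by rewrite -(Gauss_dvdpr _ (q := m %/ g)) ?E ?dvdp_mulIr // coprimep_sym.
  move=> /divpK dE; apply: contraNneq da => ea.
  by rewrite -dE hornerM ea mulr0.
by apply/eqP; rewrite eqr_div // -!hornerM E.
Qed.

Let divp_shift n d (j i : nat) : d != 0 ->
  (('X^j * n) %/ d)`_(i + j) = (n %/ d)`_i.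
Proof.
move=> d0; rewrite {1}(divp_eq n d) mulrDr mulrA divpD mulpK // coefD.
rewrite coefXnM ltnNge leq_addl /= addnK [X in _ + X]nth_default ?addr0 //.
have [->|r0] := eqVneq (n %% d) 0; first by rewrite mulr0 div0p size_poly0.
rewrite size_divp // size_monicM ?monicXn // size_polyXn.
have := ltn_modp n d; rewrite d0 => lt.
have : (0 < size d)%N by rewrite size_poly_gt0.
case: (size d) lt => // m; rewrite ltnS /= => lt _.
by rewrite leq_subLR (addnC j) leq_add // leq_addl.
Qed.

Let coef_infty_shift n d (k : int) (i j : nat) : d != 0 -> k = i%:Z - j%:Z ->
  coef_infty (tofrac n / tofrac d) k = (('X^j * n) %/ d)`_i.
Proof.
move=> d0 ek; have H := ratfun_eq (n := n) d0 erefl.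
have e0 := ratfun_den_neq0 (tofrac n / tofrac d).
have div_repr u : (u * ratfun_num (tofrac n / tofrac d))
    %/ ratfun_den (tofrac n / tofrac d) = (u * n) %/ d.
  by rewrite -(divp_pmul2r _ d0 e0) -mulrA H mulrA (mulrC _ d) divp_pmul2r.
rewrite /coef_infty; case: k ek => [m|m] ek.
  have -> : i = (m + j)%N.
    by apply/eqP; rewrite -eqz_nat PoszD ek subrK.
  by rewrite -[ratfun_num _]mul1r div_repr mul1r divp_shift.
have -> : j = (m.+1 + i)%N.
  by apply/eqP; rewrite -eqz_nat PoszD -[Posz m.+1]opprK -NegzE ek opprB subrK.
by rewrite div_repr addnC exprD -mulrA -[i in RHS]add0n divp_shift.
Qed.

Lemma coef_infty_bounded n d (k : int) : d != 0 -> (size n)%:Z <= k ->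
  coef_infty (tofrac n / tofrac d) k = 0.
Proof.
move=> d0; case: k => // m; rewrite lez_nat => le.
rewrite (@coef_infty_shift n d m m 0) ?subr0 // mul1r nth_default //.
by rewrite (leq_trans _ le) // leq_divp.
Qed.

(* d * (expansion of n / d) = n, coefficient by coefficient. *)
Lemma coef_inftyP n d (k : int) : d != 0 ->
  \sum_(j < size d) d`_j * coef_infty (tofrac n / tofrac d) (k - j%:Z) =
  match k with Posz i => n`_i | Negz _ => 0 end.
Proof.
move=> d0; pose M := (`|k| + size d)%N.
have [N eN leN] : exists2 N, k + M%:Z = N%:Z & (size d <= N)%N.
  rewrite /M; case: k {M} => m; first by exists (m + (m + size d))%N => //; rewrite addnA leq_addl.
  by exists (size d); rewrite //= PoszD NegzE addKr.
have ek : k = N%:Z - M%:Z by rewrite -eN addrK.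
have -> : \sum_(j < size d) d`_j * coef_infty (tofrac n / tofrac d) (k - j%:Z)
     = ((('X^M * n) %/ d) * d)`_N.
  rewrite [_ %/ d * d]mulrC coefM.
  rewrite (@big_ord_widen _ _ _ (size d) N.+1
     (fun j => d`_j * coef_infty (tofrac n / tofrac d) (k - j%:Z))) ?leqW //.
  rewrite big_mkcond; apply: eq_bigr => j _ /=; case: ltnP => lj; last first.
    by rewrite nth_default ?mul0r.
  rewrite (@coef_infty_shift n d _ (N - j) M) // ek -subzn; last by rewrite -ltnS.
  by rewrite addrAC.
have -> : ('X^M * n) %/ d * d = 'X^M * n - ('X^M * n) %% d.
  by rewrite {2}(divp_eq ('X^M * n) d) addrK.
rewrite coefB [X in _ - X]nth_default ?subr0; last first.
  by rewrite (leq_trans _ leN) // ltnW // ltn_modp.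
rewrite coefXnM; case: k @M ek {eN} => m M ek.
  have -> : N = (m + M)%N by apply/eqP; rewrite -eqz_nat PoszD ek subrK.
  by rewrite ltnNge leq_addl addnK.
suff -> : (N < M)%N by [].
by rewrite -ltz_nat -subr_lt0 -ek.
Qed.

End Sanity.

(* Main.v *)
(* Substituting y = z + 1 in the product that defines c_r(p) turns it into
   F(z - p) / F(z), so this quotient expands as - p sum_r c_r(p) (z + 1)^(-r);
   expanding (z + 1)^(-r) at infinity and (z)_p in powers of z gives the claim.
   Since c_r is computed over Q(x) and then evaluated at x = p, one needs that
   the expansion commutes with x |-> p: the product is a quotient of polynomials
   in y over Q[x] with monic denominator, and division by a monic polynomial
   commutes with ring morphisms. *)
Require Import Defs.
From HB Require Import structures.
From mathcomp Require Import all_boot all_order all_algebra.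
From mathcomp Require Import zify ring.

Set Implicit Arguments.
Unset Strict Implicit.
Unset Printing Implicit Defensive.

Import GRing.Theory.
Local Open Scope ring_scope.

(** * Rules for coefficients of the expansion at infinity *)

Section CoefInfty.
Variable K : fieldType.
Implicit Types (n d : {poly K}) (f g : {ratfun K}).

Lemma ratfun_fracP f : exists n d, d != 0 /\ f = tofrac n / tofrac d.
Proof.
exists (ratfun_num f), (ratfun_den f); rewrite ratfun_den_neq0; split=> //.
by rewrite -ratfun_numden mulfK // tofrac_eq0 ratfun_den_neq0.
Qed.

(** [coef_infty] reads a chosen representative; a common factor of both terms does not change the
    Euclidean quotient, so any fraction serves. *)
Lemma coef_infty_frac n d (k : int) : d != 0 ->
  coef_infty (tofrac n / tofrac d) k =
  match k with
  | Posz i => (n %/ d)`_i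
  | Negz m => (('X^(m.+1) * n) %/ d)`_0
  end.
Proof.
move=> d0; have e0 := ratfun_den_neq0 (tofrac n / tofrac d).
have H u : (u * ratfun_num (tofrac n / tofrac d))
    %/ ratfun_den (tofrac n / tofrac d) = (u * n) %/ d.
  by rewrite -(divp_pmul2r _ d0 e0) -mulrA (ratfun_eq d0 erefl) mulrA (mulrC _ d)
    divp_pmul2r.
rewrite /coef_infty; case: k => m; last by rewrite H.
by have := H 1; rewrite !mul1r => ->.
Qed.

Lemma coef_inftyD f g k : coef_infty (f + g) k = coef_infty f k + coef_infty g k.
Proof.
have [a [d [d0 ->]]] := ratfun_fracP f; have [b [e [e0 ->]]] := ratfun_fracP g.
have de0 : d * e != 0 by rewrite mulf_neq0.
have -> : tofrac a / tofrac d = tofrac (a * e) / tofrac (d * e).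
  by rewrite !tofracM -mulf_div divff ?mulr1 // tofrac_eq0.
have -> : tofrac b / tofrac e = tofrac (d * b) / tofrac (d * e).
  by rewrite !tofracM -mulf_div divff ?mul1r // tofrac_eq0.
rewrite -mulrDl -tofracD !coef_infty_frac //.
by case: k => m; rewrite ?mulrDr divpD coefD.
Qed.

Lemma coef_inftyZ c f k : coef_infty (tofrac c%:P * f) k = c * coef_infty f k.
Proof.
have [n [d [d0 ->]]] := ratfun_fracP f.
rewrite mulrA -tofracM mul_polyC !coef_infty_frac //.
by case: k => m; rewrite -?scalerAr divpZl coefZ.
Qed.

Lemma coef_infty_XM f k : coef_infty (tofrac 'X * f) k = coef_infty f (k - 1).
Proof.
have [n [d [d0 ->]]] := ratfun_fracP f.
rewrite mulrA -tofracM !coef_infty_frac //.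
case: k => [[|i]|m].
- by have -> : 0%:Z - 1 = Negz 0 by [].
- have -> : i.+1%:Z - 1 = i%:Z by rewrite -addn1 PoszD addrK.
  (* ['X * (n %% d)] has size at most that of [d]: its quotient by [d] is constant and misses the
     index [i.+1]. *)
  rewrite {1}(divp_eq n d) mulrDr mulrA divpD mulpK // coefD coefXM /=.
  rewrite [X in _ + X]nth_default ?addr0 //.
  have [->|r0] := eqVneq (n %% d) 0; first by rewrite mulr0 div0p size_poly0.
  rewrite size_divp // mulrC size_mulX //.
  by have := ltn_modp n d; rewrite d0; move: (size _) (size _) => u v; lia.
- have -> : Negz m - 1 = Negz m.+1 by lia.
  by rewrite mulrA -exprSr.
Qed.

Lemma coef_infty_XnM j f k :
  coef_infty (tofrac 'X^j * f) k = coef_infty f (k - j%:Z).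
Proof.
elim: j k => [|j IH] k; first by rewrite expr0 tofrac1 mul1r subr0.
by rewrite exprS tofracM -mulrA coef_infty_XM IH; congr coef_infty; lia.
Qed.

Lemma coef_infty_sum (I : Type) (s : seq I) (F : I -> {ratfun K}) k :
  coef_infty (\sum_(i <- s) F i) k = \sum_(i <- s) coef_infty (F i) k.
Proof.
elim: s => [|i s IH]; last by rewrite !big_cons coef_inftyD IH.
rewrite !big_nil; have := coef_inftyZ 0 0 k.
by rewrite mulr0 mul0r.
Qed.

Lemma coef_infty_polyM (P : {poly K}) N f k : (size P <= N)%N ->
  coef_infty (tofrac P * f) k = \sum_(t <- iota 0 N) P`_t * coef_infty f (k - t%:Z).
Proof.
move=> sP; have -> : P = \sum_(t <- iota 0 N) P`_t *: 'X^t.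
  have -> : iota 0 N = index_iota 0 N by rewrite /index_iota subn0.
  rewrite big_mkord -poly_def; apply/polyP=> i; rewrite coef_poly.
  by case: ltnP => // le; rewrite nth_default // (leq_trans sP).
rewrite raddf_sum mulr_suml coef_infty_sum; apply: eq_big_seq => t.
rewrite mem_iota => /= lt.
rewrite -mul_polyC tofracM -mulrA coef_inftyZ coef_infty_XnM; congr (_ * _).
rewrite coef_sum (bigD1_seq t) ?iota_uniq ?mem_iota //= big1 ?addr0 => [|i ne].
  by rewrite coefZ coefXn eqxx mulr1.
by rewrite coefZ coefXn eq_sym (negPf ne) mulr0.
Qed.

Lemma coef_infty_small n d (k : int) : d != 0 ->
  ((size n)%:Z < (size d)%:Z + k)%R -> coef_infty (tofrac n / tofrac d) k = 0.
Proof.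
move=> d0; rewrite coef_infty_frac //; have := size_poly_gt0 d; rewrite d0.
case: k => m sd lt; rewrite nth_default // size_divp //.
  by move: (size n) (size d) sd lt => u v; lia.
have [->|n0] := eqVneq n 0; first by rewrite mulr0 size_poly0.
by rewrite size_monicM ?monicXn // size_polyXn;
  move: (size n) (size d) sd lt => u v; lia.
Qed.

(** Meant for [R] = Q[x], with [phi] the embedding into Q(x) or the evaluation at [p]. *)
Lemma coef_infty_map (R : comNzRingType) (phi : {rmorphism R -> K})
    (n d : {poly R}) (r : nat) : d \is monic ->
  coef_infty (tofrac (map_poly phi n) / tofrac (map_poly phi d)) (- r%:Z) =
  phi (Pdiv.Ring.rdivp ('X^r * n) d)`_0.
Proof.
move=> md; have md' := monic_map phi md.
have E i : ('X^i * map_poly phi n) %/ map_poly phi d =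
    map_poly phi (Pdiv.Ring.rdivp ('X^i * n) d).
  have /(congr1 (map_poly phi)) := Pdiv.RingMonic.rdivp_eq md ('X^i * n).
  rewrite !rmorphM rmorphD rmorphM /= map_polyXn => H.
  (* The leading coefficient 1 of [d] survives [phi], so the image of the remainder stays smaller
     than that of [d], and Euclidean division over [K] is unique. *)
  case: (divp_modpP H) => [|-> //].
  rewrite [ltnRHS]size_map_poly_id0.
    by rewrite (leq_ltn_trans (size_poly _ _)) // Pdiv.Ring.ltn_rmodp monic_neq0.
  by rewrite (monicP md) rmorph1 oner_neq0.
rewrite coef_infty_frac ?monic_neq0 // -coef_map -E.
by case: r => [|r] //; rewrite oppr0 mul1r.
Qed.

(** By induction on r, then on s: the identity (z+1) (z+1)^(-r-1) = (z+1)^(-r) becomes Pascal's rule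
    on coefficients. *)
Lemma coef_infty_X1V (r : nat) (k : int) :
  coef_infty (tofrac 1 / tofrac (('X + 1) ^+ r) : {ratfun K}) k =
  match - (r%:Z + k) with
  | Posz s => (-1) ^+ s * (negbinom r s)%:R
  | Negz _ => 0
  end.
Proof.
have X1 : 'X + 1 != 0 :> {poly K} by rewrite -polyC1 monic_neq0 ?monicXaddC.
have tX1 : tofrac ('X + 1) != 0 :> {ratfun K} by rewrite tofrac_eq0.
have sX1 j : size (('X + 1 : {poly K}) ^+ j) = j.+1.
  by rewrite -[1]opprK -polyC1 -polyCN size_exp_XsubC.
case Es: (- _) => [s|m]; last first.
  rewrite coef_infty_small ?expf_neq0 //.
  by rewrite sX1 size_polyC oner_neq0 /=; lia.
have -> : k = - (r + s)%:Z by lia.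
elim: r s {k Es} => [|r IHr] s.
  rewrite expr0 coef_infty_frac ?oner_neq0 // /negbinom add0n.
  case: s => [|s]; first by rewrite divp1 bin0 mulr1 [LHS](coef1 K 0).
  have -> : - s.+1%:Z = Negz s by [].
  by rewrite bin_small // mulr0 divp1 mulr1 coefXn.
have step k : coef_infty (tofrac 1 / tofrac (('X + 1) ^+ r) : {ratfun K}) k =
  coef_infty (tofrac 1 / tofrac (('X + 1) ^+ r.+1)) (k - 1) +
  coef_infty (tofrac 1 / tofrac (('X + 1) ^+ r.+1)) k.
  rewrite -coef_infty_XM -coef_inftyD; congr coef_infty.
  rewrite -[X in _ = _ + X]mul1r -mulrDl.
  have -> : tofrac 'X + 1 = tofrac ('X + 1) :> {ratfun K} by rewrite tofracD tofrac1.
  rewrite tofrac1 !mul1r.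
  by rewrite exprS tofracM invfM mulrA divff ?mul1r.
elim: s => [|s IHs].
  rewrite addn0; have := step (- r%:Z); have := IHr 0%N; rewrite addn0 => ->.
  have -> : - r%:Z - 1 = - r.+1%:Z by lia.
  rewrite [X in _ + X]coef_infty_small ?expf_neq0 //; last first.
    by rewrite sX1 size_polyC oner_neq0 /=; lia.
  by rewrite addr0 /negbinom !bin0.
have := step (- (r + s.+1)%:Z); rewrite IHr.
have -> : - (r + s.+1)%:Z = - (r.+1 + s)%:Z by lia.
rewrite IHs.
have -> : - (r.+1 + s)%:Z - 1 = - (r.+1 + s.+1)%:Z by lia.
move=> /eqP; rewrite -subr_eq => /eqP <-.
rewrite /negbinom !addnS !addSn /= binS natrD exprS; ring.
Qed.

End CoefInfty.

(** * The products as polynomial fractions; evaluation at [p] and the shift y = z + 1 *)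

(* The fraction [cratio_num x lam / cratio_den x lam] is [cratio x 'X lam], the
   two sign changes per factor cancelling, in a form that makes sense over any
   commutative ring and has a monic denominator. *)
Section CRatio.
Variable R : comNzRingType.

Definition cratio_num (x : R) (lam : seq nat) : {poly R} :=
  \prod_(i < size lam) (('X - (x + 1 + (nth 0%N lam i)%:R - i.+1%:R)%:P)
                        * ('X - (1 - i.+1%:R)%:P)).

Definition cratio_den (x : R) (lam : seq nat) : {poly R} :=
  \prod_(i < size lam) (('X - (x + 1 - i.+1%:R)%:P)
                        * ('X - (1 + (nth 0%N lam i)%:R - i.+1%:R)%:P)).

Lemma cratio_den_monic x lam : cratio_den x lam \is monic.
Proof. by apply: monic_prod => i _; rewrite monicMl monicXsubC. Qed.

End CRatio.

(** The ratio thus has degree 0 in y and expands without positive powers, as [coef_infty_comp_X1]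
    requires. *)
Lemma size_cratio_num_den (R : idomainType) (x : R) lam :
  size (cratio_num x lam) = size (cratio_den x lam).
Proof.
have E (a b : R) : size (('X - a%:P) * ('X - b%:P)) = 3.
  by rewrite size_monicM ?monicXsubC ?monic_neq0 ?monicXsubC // !size_XsubC.
have NZ (a b : R) : ('X - a%:P) * ('X - b%:P) != 0 by rewrite -size_poly_gt0 E.
rewrite !size_prod => [|i _|i _]; try exact: NZ.
by congr (_.+1 - _)%N; apply: eq_bigr => i _; rewrite !E.
Qed.

Lemma map_cratio_num (R S : comNzRingType) (phi : {rmorphism R -> S}) x lam :
  map_poly phi (cratio_num x lam) = cratio_num (phi x) lam.
Proof.
rewrite rmorph_prod; apply: eq_bigr => i _.
by rewrite rmorphM /= !map_polyXsubC !(rmorphB, rmorphD, rmorph1, rmorph_nat).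
Qed.

Lemma map_cratio_den (R S : comNzRingType) (phi : {rmorphism R -> S}) x lam :
  map_poly phi (cratio_den x lam) = cratio_den (phi x) lam.
Proof.
rewrite rmorph_prod; apply: eq_bigr => i _.
by rewrite rmorphM /= !map_polyXsubC !(rmorphB, rmorphD, rmorph1, rmorph_nat).
Qed.

Section Fraction.
Variable K : fieldType.

Lemma cratioE (x : K) lam :
  cratio (tofrac x%:P) (tofrac 'X) lam
  = tofrac (cratio_num x lam) / tofrac (cratio_den x lam).
Proof.
rewrite !rmorph_prod -prodf_div; apply: eq_bigr => i _.
rewrite !(rmorphM, rmorphB, rmorphD, rmorph1, rmorph_nat) /=.
by congr (_ / _); ring.
Qed.

(** Factor by factor: at y = z + 1 the linear terms become z - p - lambda_i + i and z + i over z - p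
    + i and z - lambda_i + i. *)
Lemma frobenius_ratioE (p : nat) lam : let z : {ratfun K} := tofrac 'X in
  frobenius (z - p%:R) lam / frobenius z lam
  = tofrac (cratio_num p%:R lam \Po ('X + 1))
    / tofrac (cratio_den p%:R lam \Po ('X + 1)).
Proof.
move=> z; rewrite /frobenius /cratio_num /cratio_den !rmorph_prod /= -!prodf_div.
apply: eq_bigr => i _.
rewrite !(rmorphM, rmorphB, rmorphD, rmorph1, rmorph_nat) /= !comp_polyX.
rewrite !(rmorphM, rmorphB, rmorphD, rmorph1, rmorph_nat) /= -/z.
rewrite invf_div mulf_div; congr (_ / _); ring.
Qed.

End Fraction.

(** Both coefficients are images of one element of Q[x], the constant term of a quotient by a monic
    polynomial; [0 < p] keeps the remaining denominator x from vanishing. *)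
Lemma ccoef_eval lam r p : (0 < p)%N ->
  ratfun_eval (ccoef lam r) p%:R =
  - coef_infty (tofrac (cratio_num p%:R lam) / tofrac (cratio_den p%:R lam))
      (- r%:Z) / p%:R :> rat.
Proof.
move=> p0; have md := cratio_den_monic ('X : {poly rat}) lam.
rewrite /ccoef cratioE.
pose phi : {rmorphism {poly rat} -> {ratfun rat}} := @FracField.tofrac {poly rat}.
rewrite -[tofrac 'X]/(phi 'X) -map_cratio_num -map_cratio_den coef_infty_map //.
have -> : p%:R = horner_eval p%:R 'X :> rat by rewrite /horner_eval hornerX.
rewrite -map_cratio_num -map_cratio_den coef_infty_map //.
rewrite -rmorphN ratfun_evalE /horner_eval !hornerX ?hornerN //.
by rewrite Num.Theory.pnatr_eq0 -lt0n.
Qed.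

(* Substituting [z + 1] in [z^M n = q d + r], where
   [q = \sum_(i <= M) a_(M - i) z^i], and dividing by [(z + 1)^M] gives the
   expansion of [n / d] in powers of [(z + 1)^-1], up to [z^-M]. *)
Lemma coef_infty_comp_X1 (K : fieldType) (n d : {poly K}) (M : nat) (k : int) :
  d != 0 -> (size n <= size d)%N -> (0 <= k + M%:Z)%R ->
  coef_infty (tofrac (n \Po ('X + 1)) / tofrac (d \Po ('X + 1))) k =
  \sum_(r <- iota 0 M.+1) coef_infty (tofrac n / tofrac d) (- r%:Z)
    * coef_infty (tofrac 1 / tofrac (('X + 1) ^+ r)) k.
Proof.
move=> d0 nd kM; set a := coef_infty (_ / tofrac d).
have X1 j : ('X + 1 : {poly K}) ^+ j \is monic by rewrite monic_exp // -polyC1 monicXaddC.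
have X1u j : tofrac (('X + 1) ^+ j) != 0 :> {ratfun K} by rewrite tofrac_eq0 monic_neq0.
have sX1 j : size (('X + 1 : {poly K}) ^+ j) = j.+1.
  by rewrite -[1]opprK -polyC1 -polyCN size_exp_XsubC.
have sX : size ('X + 1 : {poly K}) = 2 by rewrite -[_ + _]expr1 sX1.
pose B : {poly K} := d \Po ('X + 1); rewrite -/B; have B0 : B != 0 by rewrite comp_poly2_eq0.
have tB0 : tofrac B != 0 :> {ratfun K} by rewrite tofrac_eq0.
pose q : {poly K} := ('X^M * n) %/ d; pose r : {poly K} := ('X^M * n) %% d.
have qa i : (i <= M)%N -> q`_(M - i) = a (- i%:Z).
  move=> iM; have -> : - i%:Z = (M - i)%:Z - M%:Z by lia.
  by rewrite /a -coef_infty_XnM mulrA -tofracM coef_infty_frac.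
have sq : (size q <= M.+1)%N.
  rewrite size_divp // leq_subLR; have := size_poly_gt0 d; rewrite d0.
  have := size_polyMleq 'X^M n; rewrite size_polyXn.
  move: (size _) (size n) (size d) nd => u v w; lia.
have qE : tofrac (q \Po ('X + 1)) / tofrac (('X + 1) ^+ M) =
    \sum_(i <- iota 0 M.+1)
      tofrac (a (- i%:Z))%:P * (tofrac 1 / tofrac (('X + 1) ^+ i)) :> {ratfun K}.
  have -> : iota 0 M.+1 = index_iota 0 M.+1 by rewrite /index_iota subn0.
  (* By [qa], [q] lists the coefficients of the expansion backwards, hence the reversed index. *)
  rewrite big_mkord (reindex_inj rev_ord_inj) /= comp_polyE.
  rewrite (big_ord_widen _ (fun i => q`_i *: ('X + 1) ^+ i) sq) big_mkcond /=.
  rewrite raddf_sum mulr_suml; apply: eq_bigr => i _ /=.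
  have iM : (i <= M)%N by rewrite -ltnS.
  rewrite subSS -qa ?leq_subr // subKn //.
  have -> : (if (i < size q)%N then q`_i *: ('X + 1) ^+ i else 0)
            = (q`_i)%:P * ('X + 1) ^+ i.
    by rewrite mul_polyC; case: ltnP => // le; rewrite nth_default // scale0r.
  rewrite tofracM -mulrA; congr (_ * _).
  rewrite -[X in (tofrac (_ ^+ X))^-1](subnK iM) exprD tofracM invfM mulrA.
  by rewrite mulrAC divff ?X1u // tofrac1.
have E : tofrac (n \Po ('X + 1)) / tofrac B =
    tofrac (q \Po ('X + 1)) / tofrac (('X + 1) ^+ M)
    + tofrac (r \Po ('X + 1)) / tofrac (B * ('X + 1) ^+ M) :> {ratfun K}.
  have -> : tofrac (q \Po ('X + 1)) / tofrac (('X + 1) ^+ M) =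
      tofrac ((q \Po ('X + 1)) * B) / tofrac (B * ('X + 1) ^+ M) :> {ratfun K}.
    by rewrite !tofracM invfM mulrA (mulfK tB0).
  rewrite -mulrDl -tofracD /B -rmorphM -rmorphD /= -divp_eq rmorphM rmorphXn /=.
  by rewrite comp_polyX -/B !tofracM invfM
    (mulrC (tofrac ((_ + _) ^+ _))) mulrACA divff ?X1u // mulr1.
(* The remainder term has degree below -M, hence below [k], and contributes nothing. *)
rewrite E coef_inftyD [X in _ + X]coef_infty_small ?mulf_neq0 ?(monic_neq0 (X1 _)) // ?addr0.
  by rewrite qE coef_infty_sum; apply: eq_bigr => i _; rewrite coef_inftyZ.
rewrite size_Mmonic // sX1 !size_comp_poly2 //.
have := ltn_modp ('X^M * n) d; rewrite d0 -/r; move: (size r) (size d) => u v; lia.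
Qed.

(** * The lowering factorial and the triple sum *)

Lemma coef_lowering_factorial (R : nzRingType) p t :
  (lowering_factorial ('X : {poly R}) p)`_t = (stirling1 p t)%:~R.
Proof.
rewrite -[RHS](coef_map intr); congr (polyseq _)`_t.
rewrite /lowering_factorial rmorph_prod; apply: eq_bigr => i _.
by rewrite rmorphB /= map_polyX rmorph_nat.
Qed.

Lemma size_lowering_factorial (R : nzRingType) p :
  size (lowering_factorial ('X : {poly R}) p) = p.+1.
Proof.
rewrite /lowering_factorial.
under eq_bigr => i _ do rewrite -polyC_natr.
by rewrite size_prod_XsubC [index_enum _]unlock -enumT size_enum_ord.
Qed.

Theorem theorem2 (lam : seq nat) (p : nat)
    (hlam : is_partition lam) (hp : (0 < p)%N) :
  let z : {ratfun rat} := tofrac 'X in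
  exists2 S : int -> rat,
    formal_sum
      (fun rst : nat * nat * nat =>
         let: (r, s, t) := rst in
         zmonomial
           ((-1) ^+ s * (negbinom r s)%:R * (stirling1 p t)%:~R
              * ratfun_eval (ccoef lam r) p%:R)
           (t%:Z - r%:Z - s%:Z))
      S
  & forall k : int,
      coef_infty (lowering_factorial z p
                    * (frobenius (z - p%:R) lam / frobenius z lam)) k
      = - p%:R * S k.
Proof.
move=> z; set f := lowering_factorial z p * _.
have p0 : p%:R != 0 :> rat by rewrite Num.Theory.pnatr_eq0 -lt0n.
(* The second claim forces this [S]; what remains is that the family sums to it. *)
exists (fun k => coef_infty f k / - p%:R) => [k|k]; last first.
  by rewrite mulrC divfK // oppr_eq0.
(* A nonzero term has t <= p and r + s = t - k, so [M] bounds both r and s; it also gives 0 <= k - t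
   + M, the range of [coef_infty_comp_X1]. *)
pose M := (p + `|k|)%N.
exists [seq (rs, t) | rs <- [seq (r, s) | r <- iota 0 M.+1, s <- iota 0 M.+1],
                      t <- iota 0 p.+1]; split.
- by apply: allpairs_uniq => [||[? ?] [? ?] _ _ [-> ->]] //; rewrite ?iota_uniq //;
    apply: allpairs_uniq => [||[? ?] [? ?] _ _ [-> ->]] //; rewrite iota_uniq.
- move=> [[r s] t] H; rewrite /zmonomial.
  have [tp|tp] := ltnP p t.
    have -> : stirling1 p t = 0 by rewrite /stirling1 nth_default ?size_lowering_factorial.
    by rewrite mulr0 mul0r if_same.
  case: eqP => // kE; case/negP: H.
  apply/allpairsP; exists (r, s, t); split; [|by rewrite mem_iota|by []].
  by apply/allpairsP; exists (r, s); split=> //; rewrite mem_iota /M add0n /fst /snd; lia.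
rewrite !big_allpairs.
rewrite /f frobenius_ratioE.
have -> : lowering_factorial z p = tofrac (lowering_factorial 'X p).
  rewrite /lowering_factorial rmorph_prod; apply: eq_bigr => i _ /=.
  by rewrite rmorphB /= rmorph_nat.
rewrite (@coef_infty_polyM _ _ p.+1) ?size_lowering_factorial // mulr_suml.
set I := iota 0 M.+1; set T := iota 0 p.+1.
(* The order becomes t, r, s: multiplication by (z)_p, expansion in (z+1)^(-1), then the binomial
   series. *)
under [RHS]eq_bigr => r _ do rewrite exchange_big /=.
rewrite exchange_big /= /T /I; apply: eq_big_seq => t;
  rewrite mem_iota add0n => tp.
rewrite (@coef_infty_comp_X1 _ _ _ M) ?monic_neq0 ?cratio_den_monic //; first last.
- by rewrite /M; lia.
- by rewrite size_cratio_num_den.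
rewrite mulr_sumr mulr_suml; apply: eq_big_seq => r; rewrite mem_iota add0n => rM.
rewrite ccoef_eval // coef_infty_X1V coef_lowering_factorial.
set a := coef_infty _ _; rewrite /zmonomial.
(* For fixed t and r only s = t - k - r can contribute, and nothing does when this is negative. *)
case Es: (- _) => [s|m].
  have sM : s \in iota 0 M.+1 by rewrite mem_iota add0n /M; lia.
  rewrite (bigD1_seq s) ?iota_uniq //.
  rewrite big1 => [|i ne]; last by case: eqP => // kE; lia.
  have -> /= : k == t%:Z - r%:Z - s%:Z by lia.
  by rewrite addr0; field.
by rewrite big1 ?mulr0 ?mul0r // => i _; case: eqP => // kE; lia.
Qed.
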